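(* Let $1<p\le q<\infty$ and $1\le r,s\le\infty$. (i) If $1\le s_0\le s_1\le\infty$, then $A_{(p,r),(q,s_0)}\subset A_{(p,r),(q,s_1)}$. (ii) If $1\le r_0\le r_1\le\infty$, then $A_{(p,r_1),(q,s)}\subset A_{(p,r_0),(q,s)}$.
   Context: A weight is a measurable function on $\mathbb R^d$ with values in $(0,\infty)$ almost everywhere. For a measurable $f$ on $\mathbb R^d$ with decreasing rearrangement $f^*$, $\|f\|_{L^{a,b}}:=\big(\frac ba\int_0^\infty[t^{1/a}f^*(t)]^b\frac{dt}t\big)^{1/b}$ for $0<a,b<\infty$, and $\|f\|_{L^{a,\infty}}:=\sup_{t>0}t^{1/a}f^*(t)$. For a cube $Q$ (sides parallel to the axes), $\|h\|_{L^{a,b}(Q)}:=|Q|^{-1/a}\|h\mathbf 1_Q\|_{L^{a,b}}$. Primes denote conjugate exponents, $1'=\infty$, $\infty'=1$. For $1<p\le q<\infty$ and $1\le r,s\le\infty$, a weight $w$ on $\mathbb R^d$ belongs to $A_{(p,r),(q,s)}$ if $$[w]_{A_{(p,r),(q,s)}}:=\sup_Q\|w\|_{L^{q,s}(Q)}\,\|w^{-1}\|_{L^{p',r'}(Q)}<\infty,$$ the supremum being over all cubes $Q\subset\mathbb R^d$. *)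

(* Defs.v *)
From HB Require Import structures.
From mathcomp Require Import all_boot all_order all_algebra.
From mathcomp Require Import all_classical all_reals all_analysis.
From mathcomp Require Import measurable_realfun.
Set Implicit Arguments.
Unset Strict Implicit.
Unset Printing Implicit Defensive.
Import Order.TTheory GRing.Theory Num.Theory.
Import numFieldNormedType.Exports.
Local Open Scope classical_set_scope.
Local Open Scope ring_scope.

Section boxes.
Context {R : realType} {d : nat}.
Implicit Types a b : 'rV[R]_d.

Definition box (ab : 'rV[R]_d * 'rV[R]_d) : set 'rV[R]_d :=
  [set x | forall i, ab.1 0 i <= x 0 i < ab.2 0 i].

(* The truncation at 0 gives volume 0 to the boxes that are empty because
   some endpoints are in the wrong order. *)
Definition box_volume (ab : 'rV[R]_d * 'rV[R]_d) : R :=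
  \prod_(i < d) Num.max 0 (ab.2 0 i - ab.1 0 i).

Lemma box_volume_ge0 ab : 0 <= box_volume ab.
Proof. by apply: prodr_ge0 => i _; rewrite le_max lexx. Qed.

Definition box_cover (X : set 'rV[R]_d) : set (nat -> 'rV[R]_d * 'rV[R]_d) :=
  [set B | X `<=` \bigcup_k box (B k)].

End boxes.

(* From here on the ambient space is R^(d+1): the parameter d is the dimension
   minus one, which makes every dimension at least 1. *)
Section lebesgue_outer.
Context (R : realType) (d : nat).
Local Open Scope ereal_scope.

Definition lebesgue_outer (X : set 'rV[R]_d.+1) : \bar R :=
  ereal_inf [set \sum_(k <oo) (box_volume (B k))%:E | B in box_cover X].

Let lebesgue_outer_ge0 X : 0 <= lebesgue_outer X.
Proof.
apply: le_ereal_inf_tmp => _ [B _ <-].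
by apply: nneseries_ge0 => k _ _; rewrite lee_fin box_volume_ge0.
Qed.

Let le_lebesgue_outer : {homo lebesgue_outer : A B / A `<=` B >-> A <= B}.
Proof.
move=> A B AB; apply/ereal_inf_le_tmp => x [C BC <-]; exists C => //.
exact: subset_trans AB BC.
Qed.

Let lebesgue_outer0 : lebesgue_outer set0 = 0.
Proof.
apply/eqP; rewrite eq_le lebesgue_outer_ge0 andbT.
apply: ereal_inf_lbound; exists (fun=> (0, 0)%R) => //.
apply: eseries0 => k _ _.
by rewrite /box_volume (bigD1 ord0)//= !mxE subrr maxxx mul0r.
Qed.

Let lebesgue_outer_sigma_subadditive : sigma_subadditive lebesgue_outer.
Proof.
move=> A; have [[i ioo]|] := pselect (exists i, lebesgue_outer (A i) = +oo).
  rewrite (eseries_pinfty _ _ ioo) ?leey// => n _.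
  by rewrite -ltNye (lt_le_trans _ (lebesgue_outer_ge0 _)).
rewrite -forallNE => Aoo.
suff add2e (e : {posnum R}) : lebesgue_outer (\bigcup_n A n) <=
    \sum_(i <oo) lebesgue_outer (A i) + e%:num%:E.
  by apply/lee_addgt0Pr => _/posnumP[].
rewrite (le_trans _ (epsilon_trick _ _ _))//.
pose P n B := box_cover (A n) B /\ \sum_(k <oo) (box_volume (B k))%:E <=
  lebesgue_outer (A n) + (e%:num / (2 ^ n.+1)%:R)%:E.
have [G PG] : {G : nat -> nat -> 'rV[R]_d.+1 * 'rV[R]_d.+1 &
    forall n, P n (G n)}.
  apply: (@choice _ _ P) => n; rewrite /P.
  have en1 : (0 < e%:num / (2 ^ n.+1)%:R :> R)%R by [].
  have fA : lebesgue_outer (A n) \is a fin_num.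
    by rewrite ge0_fin_numE// ltey; apply/eqP; exact: Aoo.
  have [_ [B AB <-] Bx] := lb_ereal_inf_adherent en1 fA.
  by exists B; split => //; exact: ltW.
pose v (ij : nat * nat) : \bar R := (box_volume (G ij.1 ij.2))%:E.
have v0 ij : 0 <= v ij by rewrite lee_fin box_volume_ge0.
apply: (@le_trans _ _ (\esum_(i in setT) v i)).
  apply: ereal_inf_lbound => /=.
  have /card_esym/ppcard_eqP[f] := card_nat2.
  exists (fun k => G (f k).1 (f k).2).
    move=> t [i _ Ait]; have [j _ Gt] := (PG i).1 t Ait.
    by exists (f^-1%FUN (i, j)) => //=; rewrite invK ?inE.
  rewrite -[LHS](esum_pred_image v _ xpredT) ?[fun=> _]set_true//.
  by rewrite image_eq.
rewrite (_ : esum _ _ = \sum_(i <oo) \sum_(j <oo) v (i, j)); last first.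
  pose J : nat -> set (nat * nat) := fun i => [set (i, j) | j in setT].
  rewrite (_ : setT = \bigcup_k J k); last first.
    by rewrite predeqE => -[a b]; split => // _; exists a => //; exists b.
  rewrite esum_bigcupT /=; last 2 first.
    - apply/trivIsetP => i j _ _ ij.
      rewrite predeqE => -[n m] /=; split => //= -[] [_] _ [<-{n} _].
      by move=> [m' _] [] /esym/eqP; rewrite (negbTE ij).
    - by move=> *; exact: v0.
  rewrite -nneseries_esumT//; last first.
    by move=> n; apply: esum_ge0 => *; exact: v0.
  apply: eq_eseriesr => n _.
  rewrite -(esum_pred_image v (pair n) predT) => //.
  - by congr esum; rewrite /J predeqE => -[a b]; split=> -[i _ <-]; exists i.
  - by move=> ? ? _ _ [].
apply: lee_nneseries => [n _ |n _]; last exact: (PG n).2.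
by move=> _; apply: nneseries_ge0 => *; exact: v0.
Qed.

HB.instance Definition _ := isOuterMeasure.Build R 'rV[R]_d.+1 lebesgue_outer
  lebesgue_outer0 lebesgue_outer_ge0 le_lebesgue_outer
  lebesgue_outer_sigma_subadditive.

End lebesgue_outer.

(* R^(d+1) with the sigma-algebra of Lebesgue measurable sets, obtained as the
   Caratheodory measurable sets of the Lebesgue outer measure. *)
Notation euclid R d := (caratheodory_type (@lebesgue_outer R d)).

Section lorentz.
Context {R : realType} {d : nat}.
Implicit Types (f h w : euclid R d -> \bar R) (Q : set (euclid R d)).
Local Open Scope ereal_scope.

Definition leb : set (euclid R d) -> \bar R := @lebesgue_outer R d.

HB.instance Definition _ := isMeasure.Build _ _ _ leb
  (@caratheodory_measure0 _ _ (@lebesgue_outer R d))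
  (@caratheodory_measure_ge0 _ _ (@lebesgue_outer R d))
  (@caratheodory_measure_sigma_additive _ _ (@lebesgue_outer R d)).

Definition rearrangement f (t : R) : \bar R :=
  ereal_inf [set lam%:E | lam in
    [set lam : R | (0 <= lam)%R /\ leb [set x | lam%:E < `|f x|] <= t%:E]].

(* The branch b = -oo is junk: the norm is used for 0 < b only. *)
Definition lorentz_norm (a : R) (b : \bar R) f : \bar R :=
  match b with
  | b%:E => ((b / a)%:E * \int[lebesgue_measure]_(t in `]0%R, +oo[)
      (((t `^ a^-1)%:E * rearrangement f t) `^ b * t^-1%:E)) `^ b^-1
  | +oo => ereal_sup
      [set (t `^ a^-1)%:E * rearrangement f t | t in `]0%R, +oo[]
  | -oo => 0
  end.

Definition cube (c : 'rV[R]_d.+1) (l : R) : set (euclid R d) :=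
  [set x : 'rV[R]_d.+1 | forall i, (c 0 i <= x 0 i <= c 0 i + l)%R].

Definition is_cube Q := exists c l, (0 < l)%R /\ Q = cube c l.

Definition lorentz_norm_on (a : R) (b : \bar R) Q h : \bar R :=
  leb Q `^ (- a^-1) * lorentz_norm a b (fun x => h x * (\1_Q x)%:E).

Definition weight w :=
  measurable_fun setT w /\ {ae leb, forall x, 0 < w x < +oo}.

Definition A_const (p : R) (r : \bar R) (q : R) (s : \bar R) w : \bar R :=
  ereal_sup [set lorentz_norm_on q s Q w *
    lorentz_norm_on (fine (hoelder_conjugate p%:E)) (hoelder_conjugate r) Q
      (fun x => (w x)^-1) | Q in is_cube].

Definition A_class (p : R) (r : \bar R) (q : R) (s : \bar R) :
    set (euclid R d -> \bar R) :=
  [set w | weight w /\ A_const p r q s w < +oo].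

End lorentz.

Arguments A_class R d p r q s : clear implicits.

(* Main.v *)
(* The classes are nested because the Lorentz quasinorms are: with
   N b = ||f||_{a,b}, we have N b1 <= C N b0 for b0 <= b1, where C does not
   depend on f. Put g(t) = t^(1/a) f^*(t). As f^* is nonincreasing, the mass
   that the integral for N b0 has on [t/2, t] bounds g(t) by C N b0, which is
   the case b1 = oo; for b1 < oo, split g^b1 = g^(b1-b0) g^b0 and bound the
   first factor by (C N b0)^(b1-b0). The second inclusion is the same fact for
   w^-1, since r |-> r' reverses the order. *)
Require Import Defs.
From HB Require Import structures.
From mathcomp Require Import all_boot all_order all_algebra.
From mathcomp Require Import all_classical all_reals all_analysis.
From mathcomp Require Import measurable_realfun ring.
Set Implicit Arguments.
Unset Strict Implicit.
Unset Printing Implicit Defensive.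
Import Order.TTheory GRing.Theory Num.Theory.
Import numFieldNormedType.Exports.
Local Open Scope classical_set_scope.
Local Open Scope ring_scope.

(** Preimages of the rays []r, +oo]] are closed under passing to smaller arguments, so they are
    intervals. *)
Lemma antitone_emeasurable (R : realType) (F : R -> \bar R) :
  (forall x y, x <= y -> (F y <= F x)%E) -> measurable_fun setT F.
Proof.
move=> Fanti; apply: (measurability (@ErealGenOInfty.G R)).
  exact: ErealGenOInfty.measurableE.
move=> _ [_ [r ->] <-]; apply: measurableI => //; apply: is_interval_measurable.
move=> x y /= _ Fy z /andP[_ zy].
by move: Fy; rewrite !in_itv/= !andbT => /lt_le_trans; apply; exact: Fanti.
Qed.

Lemma le_poweR (R : realType) (r : R) (x y : \bar R) : 0 <= r ->
  (0 <= x)%E -> (x <= y)%E -> (x `^ r <= y `^ r)%E.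
Proof.
move=> r0 x0 xy; apply: gt0_ler_poweR => //; rewrite in_itv/= leey andbT//.
exact: le_trans xy.
Qed.

Definition weak_const (R : realType) (a b : R) : R :=
  (b / a * (2^-1 * (2^-1 `^ a^-1) `^ b))^-1 `^ b^-1.

(** The factor [b1 / b0] is the quotient of the normalisations [b1 / a] and [b0 / a]; the power of
    [weak_const] comes from the factor g^(b1-b0) split off the integrand. *)
Definition embedding_const (R : realType) (a b0 b1 : R) : R :=
  (b1 / b0 * weak_const a b0 `^ (b1 - b0)) `^ b1^-1.

Lemma weak_const_gt0 (R : realType) (a b : R) : 0 < a -> 0 < b ->
  0 < weak_const a b.
Proof.
move=> a0 b0; rewrite powR_gt0// invr_gt0.
by rewrite !mulr_gt0// ?invr_gt0// ?powR_gt0// ?invr_gt0.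
Qed.

(** * Lorentz functionals of a nonincreasing function *)

Section antitone_lorentz.
Context {R : realType} (F : R -> \bar R).
Hypothesis F0 : forall t, (0 <= F t)%E.
Hypothesis Fanti : forall x y, x <= y -> (F y <= F x)%E.
Variable a : R.
Hypothesis a0 : 0 < a.
Local Open Scope ereal_scope.

Let g (t : R) := (t `^ a^-1)%:E * F t.
Let D : set R := `]0%R, +oo[.
Let h (b : R) (t : R) := g t `^ b * t^-1%:E.
Let N (b : R) := ((b / a)%:E * \int[lebesgue_measure]_(t in D) h b t) `^ b^-1.

Let mD : measurable D.
Proof. exact: measurable_itv. Qed.

Let g0 t : 0 <= g t.
Proof. by apply: mule_ge0 => //; rewrite lee_fin powR_ge0. Qed.

Let h0 b t : D t -> 0 <= h b t.
Proof.
rewrite /D/= in_itv/= andbT => t0.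
by rewrite mule_ge0 ?poweR_ge0// lee_fin invr_ge0 ltW.
Qed.

Let mh b : measurable_fun D (h b).
Proof.
apply: emeasurable_funM.
  apply: (@measurableT_comp _ _ _ _ _ _ (fun x => x `^ b) _ g).
    exact: measurable_poweR.
  apply: measurable_funTS; apply: emeasurable_funM.
    by apply/measurable_EFinP; exact: measurable_powR.
  exact: antitone_emeasurable.
apply/measurable_EFinP.
apply: (@eq_measurable_fun _ _ _ _ _ (fun t : R => t `^ (-1))%R).
  move=> t; rewrite inE /D/= in_itv/= andbT => t0.
  by rewrite powR_inv1// ltW.
by apply: measurable_funTS; exact: measurable_powR.
Qed.

(* On [t/2, t] the integrand defining N b is at least
   ((t/2) `^ a^-1 * F t) `^ b * t^-1, whence the value of weak_const. *)
Lemma antitone_weak_type (b t : R) : (0 < b)%R -> (0 < t)%R ->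
  g t <= (weak_const a b)%:E * N b.
Proof.
move=> b0 t0; rewrite /weak_const.
set c : R := (b / a * (2^-1 * (2^-1 `^ a^-1) `^ b))%R.
have c0 : (0 < c)%R.
  by rewrite !mulr_gt0// ?invr_gt0// ?powR_gt0// ?invr_gt0.
(* Comparing b-th powers is enough: taking the root of [c^-1] produces [weak_const a b]. *)
suff X : c%:E * g t `^ b <= (b / a)%:E * \int[lebesgue_measure]_(t in D) h b t.
  have gE : g t = (g t `^ b) `^ b^-1.
    by rewrite -poweRrM divff ?gt_eqF// poweRe1.
  rewrite gE /N -poweR_EFin -poweRM//; last 2 first.
  - by rewrite lee_fin invr_ge0 ltW.
  - apply: mule_ge0; first by rewrite lee_fin divr_ge0// ltW.
    by apply: integral_ge0 => x; exact: h0.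
  apply: le_poweR; [by rewrite invr_ge0 ltW|exact: poweR_ge0|].
  by rewrite -[leLHS]mul1e -(mulVf (lt0r_neq0 c0)) EFinM -muleA
    lee_wpmul2l// lee_fin invr_ge0 ltW.
rewrite /c EFinM -muleA; apply: lee_wpmul2l.
  by rewrite lee_fin divr_ge0// ltW.
pose K := ((t / 2) `^ a^-1)%:E * F t.
pose A : set R := `[(t / 2)%R, t]%classic.
have t20 : (0 < t / 2)%R by rewrite divr_gt0.
have AD : A `<=` D.
  move=> x; rewrite /A/D/= !in_itv/= andbT => /andP[+ _].
  exact: lt_le_trans.
have mA : measurable A by exact: measurable_itv.
(* The lower bound is the integral of a constant over [A]: the length t/2 times 1/t gives the factor
   1/2, and (t/2)^(1/a) inside [K] gives the power of 1/2. *)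
have -> : (2^-1 * 2^-1 `^ a^-1 `^ b)%:E * g t `^ b =
    \int[lebesgue_measure]_(x in A) (cst (K `^ b * t^-1%:E) x).
  rewrite integral_cst//= /A lebesgue_measure_itv/= lte_fin.
  rewrite ltr_pdivrMr// ltr_pMr// ltr1n -EFinD.
  have -> : (t - t / 2 = t * 2^-1)%R by rewrite {1}(splitr t) addrK.
  have -> : K = (2^-1 `^ a^-1)%:E * g t.
    by rewrite /K mulrC powRM ?ltW ?invr_gt0// EFinM muleA.
  rewrite poweRM ?lee_fin ?powR_ge0// -muleA -EFinM mulrA mulVf ?gt_eqF// mul1r.
  by rewrite [RHS]muleC EFinM -muleA.
apply: (@le_trans _ _ (\int[lebesgue_measure]_(x in A) h b x)); last first.
  by apply: ge0_subset_integral => //; [exact: (mh b)|move=> x; exact: h0].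
apply: ge0_le_integral => //.
- by move=> x _; rewrite mule_ge0 ?poweR_ge0// lee_fin invr_ge0 ltW.
- exact: measurable_funS AD (mh b).
(* From t/2 <= x comes the bound on the power of x; from x <= t come those on [F x] and [x^-1]. *)
move=> x; rewrite /A/= in_itv/= => /andP[tx xt].
have x0 : (0 < x)%R by exact: lt_le_trans tx.
apply: lee_pmul.
- exact: poweR_ge0.
- by rewrite lee_fin invr_ge0 ltW.
- apply: le_poweR; [exact: ltW| |].
  + by rewrite mule_ge0// lee_fin powR_ge0.
  apply: lee_pmul => //.
  + by rewrite lee_fin powR_ge0.
  + rewrite lee_fin ge0_ler_powR// ?nnegrE ?invr_ge0.
    * exact: ltW.
    * exact: ltW.
    * exact: ltW.
  + exact: Fanti.
by rewrite lee_fin lef_pV2.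
Qed.

Lemma antitone_lorentz_embedding (b0 b1 : R) : (0 < b0)%R -> (b0 <= b1)%R ->
  N b1 <= (embedding_const a b0 b1)%:E * N b0.
Proof.
move=> b00 b01; have b10 : (0 < b1)%R by exact: lt_le_trans b01.
have C0 := weak_const_gt0 a0 b00.
have gC t : (0 < t)%R -> _ := @antitone_weak_type b0 t b00.
rewrite /embedding_const; set C := weak_const _ _ in C0 gC *.
set K := ((b1 / b0 * C `^ (b1 - b0)) `^ b1^-1)%R.
have K0 : (0 < b1 / b0 * C `^ (b1 - b0))%R.
  by rewrite mulr_gt0 ?divr_gt0// powR_gt0.
have I0 b : 0 <= \int[lebesgue_measure]_(t in D) h b t.
  by apply: integral_ge0 => x; exact: h0.
have X0 b : (0 < b)%R ->
    0 <= (b / a)%:E * \int[lebesgue_measure]_(t in D) h b t.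
  by move=> bp; rewrite mule_ge0// lee_fin divr_ge0// ltW.
have NX : N b0 `^ b0 = (b0 / a)%:E * \int[lebesgue_measure]_(t in D) h b0 t.
  by rewrite /N -poweRrM mulVf ?gt_eqF// poweRe1// X0.
have N00 : 0 <= N b0 by exact: poweR_ge0.
(* If [N b0] is infinite, so is the right-hand side, the constant being positive. Otherwise the
   computation can be carried out in the reals. *)
case E : (N b0) => [n| |];
  [|by rewrite gt0_muley ?leey// lte_fin powR_gt0|by rewrite E in N00].
have n0 : (0 <= n)%R by rewrite -lee_fin -E.
have X1 : (b1 / a)%:E * \int[lebesgue_measure]_(t in D) h b1 t <=
    (b1 / b0 * C `^ (b1 - b0))%:E * (n%:E `^ b1).
  have step : \int[lebesgue_measure]_(t in D) h b1 t <=
      ((C * n) `^ (b1 - b0))%:E * \int[lebesgue_measure]_(t in D) h b0 t.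
    rewrite -ge0_integralZl//; last 3 first.
    - exact: (mh b0).
    - exact: h0.
    - by rewrite lee_fin powR_ge0.
    apply: ge0_le_integral => //.
    - exact: h0.
    - exact: (mh b1).
    - exact: (emeasurable_funM (measurable_cst _) (mh b0)).
    move=> t Dt; rewrite /h muleA; apply: lee_wpmul2r.
      by move: Dt; rewrite /D/= in_itv/= andbT lee_fin invr_ge0 => /ltW.
    (* [g t] may be 0 or [+oo], where the law of exponents can fail; it holds here because the
       exponents add up to [b1], which is nonzero. *)
    rewrite -{1}(subrK b0 b1) poweRD; last first.
      by apply: add_neq0_poweRD_def; rewrite subrK gt_eqF.
    apply: lee_wpmul2r; first exact: poweR_ge0.
    rewrite -poweR_EFin; apply: le_poweR; [by rewrite subr_ge0|exact: g0|].
    by move: Dt; rewrite /D/= in_itv/= andbT => /gC; rewrite E.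
  apply: (@le_trans _ _ ((b1 / a)%:E * (((C * n) `^ (b1 - b0))%:E *
      \int[lebesgue_measure]_(t in D) h b0 t))).
    by apply: lee_wpmul2l => //; rewrite lee_fin divr_ge0// ltW.
  (* Undoing the root and the normalisation in [N b0] recovers the integral. *)
  have -> : \int[lebesgue_measure]_(t in D) h b0 t = (a / b0 * n `^ b0)%:E.
    rewrite EFinM -poweR_EFin -E NX muleA -EFinM.
    by rewrite mulrA divfK ?gt_eqF// divff ?gt_eqF// mul1e.
  rewrite poweR_EFin -!EFinM lee_fin powRM ?(ltW C0)//.
  have -> : (n `^ b1 = n `^ (b1 - b0) * n `^ b0)%R.
    rewrite -powRD ?subrK//; apply/implyP => /eqP b1E.
    by rewrite b1E ltxx in b10.
  rewrite le_eqVlt; apply/orP; left; apply/eqP.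
  have : a != 0%R by rewrite gt_eqF.
  move=> an; have bn : b0 != 0%R by rewrite gt_eqF.
  set u := (C `^ _)%R; set v := (n `^ (b1 - b0))%R; set w := (n `^ b0)%R.
  by field; apply/andP.
rewrite /N; apply: (@le_trans _ _
    (((b1 / b0 * C `^ (b1 - b0))%:E * n%:E `^ b1) `^ b1^-1)).
  by apply: le_poweR; [rewrite invr_ge0 ltW|exact: X0|].
rewrite poweRM ?poweR_ge0 ?lee_fin ?(ltW K0)//.
by rewrite -powRrM divff ?gt_eqF// powRr1.
Qed.

End antitone_lorentz.

(** * Lorentz quasinorms on Euclidean space *)

Section lorentz_embedding.
Context {R : realType} {d : nat}.
Implicit Types f : euclid R d -> \bar R.
Local Open Scope ereal_scope.

Lemma rearrangement_ge0 f (t : R) : 0 <= rearrangement f t.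
Proof. by apply: le_ereal_inf_tmp => _ [l [l0 _] <-]; rewrite lee_fin. Qed.

Lemma rearrangement_antitone f (t u : R) : (t <= u)%R ->
  rearrangement f u <= rearrangement f t.
Proof.
move=> tu; apply: ereal_inf_le_tmp => _ [l [l0 lt] <-]; exists l => //; split => //.
by apply: (le_trans lt); rewrite lee_fin.
Qed.

Lemma lorentz_norm_ge0 (a : R) (b : \bar R) f : 0 <= lorentz_norm a b f.
Proof.
case: b => [b| |//] /=; first exact: poweR_ge0.
apply: (@le_trans _ _ ((1 `^ a^-1)%:E * rearrangement f 1)).
  by rewrite mule_ge0 ?rearrangement_ge0// lee_fin powR_ge0.
by apply: ereal_sup_ubound; exists 1%R => //=; rewrite in_itv/= ltr01.
Qed.

Lemma lorentz_norm_on_ge0 (a : R) (b : \bar R) (Q : set (euclid R d)) f :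
  0 <= lorentz_norm_on a b Q f.
Proof. by rewrite mule_ge0 ?poweR_ge0 ?lorentz_norm_ge0. Qed.

(** The estimates for nonincreasing functions apply to [rearrangement f]. Their constants involve
    only the exponents, so [C] can be chosen before [f]. *)
Lemma lorentz_norm_embedding (a : R) (b0 b1 : \bar R) : (0 < a)%R ->
  0 < b0 -> b0 <= b1 -> exists C : R, (0 < C)%R /\
    forall f, lorentz_norm a b1 f <= C%:E * lorentz_norm a b0 f.
Proof.
move=> a0; case: b0 => [b0| |//]; last first.
  rewrite leye_eq => _ /eqP ->; exists 1%R; split => // f.
  by rewrite mul1e.
rewrite lte_fin => b00; case: b1 => [b1| |//].
  rewrite lee_fin => b01; exists (embedding_const a b0 b1); split.
    have b10 : (0 < b1)%R by exact: lt_le_trans b01.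
    apply: powR_gt0; apply: mulr_gt0; first exact: divr_gt0.
    by apply: powR_gt0; exact: weak_const_gt0.
  move=> f; apply: antitone_lorentz_embedding => //.
  - exact: rearrangement_ge0.
  - exact: rearrangement_antitone.
(* For [b1 = +oo] the norm is a supremum over t, bounded term by term by the weak-type estimate. *)
move=> _; exists (weak_const a b0); split; first exact: weak_const_gt0.
move=> f; apply: ge_ereal_sup => _ [t + <-].
rewrite /= in_itv/= andbT => t0; apply: antitone_weak_type => //.
- exact: rearrangement_ge0.
- exact: rearrangement_antitone.
Qed.

(** The factor |Q|^(-1/a) is the same for both second exponents, so one constant serves every
    [Q]. *)
Lemma lorentz_norm_on_embedding (a : R) (b0 b1 : \bar R) : (0 < a)%R ->
  0 < b0 -> b0 <= b1 -> exists C : R, (0 < C)%R /\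
    forall (Q : set (euclid R d)) f,
      lorentz_norm_on a b1 Q f <= C%:E * lorentz_norm_on a b0 Q f.
Proof.
move=> a0 b00 b01.
have [C [C0 CP]] := lorentz_norm_embedding a0 b00 b01.
exists C; split => // Q f; rewrite /lorentz_norm_on [leRHS]muleCA.
by apply: lee_wpmul2l; [exact: poweR_ge0|exact: CP].
Qed.

End lorentz_embedding.

(** * Conjugate exponents and the weight classes *)

Lemma le_hoelder_conjugate (R : realType) (r0 r1 : \bar R) :
  (1 <= r0)%E -> (r0 <= r1)%E ->
  (hoelder_conjugate r1 <= hoelder_conjugate r0)%E.
Proof.
case: r0 => [x| |//]; last first.
  by rewrite leye_eq => _ /eqP ->.
move=> x1; case: r1 => [y| |//]; last first.
  by move=> _; rewrite hoelder_conjugatey hoelder_conj_ge1.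
move: x1; rewrite !lee_fin le_eqVlt => /predU1P[<- _|x1 xy].
  by rewrite hoelder_conjugate1 leey.
have y1 : 1 < y by exact: lt_le_trans xy.
(* With the endpoints 1 and [+oo] settled, the conjugates are x/(x-1) and y/(y-1);
   cross-multiplication reduces the claim to x <= y. *)
rewrite /hoelder_conjugate/= !eqe !gt_eqF ?(lt_trans ltr01)//.
rewrite -!EFinB !inver !gt_eqF ?subr_gt0// -!EFinM lee_fin.
rewrite ler_pdivrMr ?subr_gt0// mulrAC ler_pdivlMr ?subr_gt0//.
by rewrite !mulrBr !mulr1 mulrC lerD2l lerN2.
Qed.

(** The embedding for w^-1 needs its first index to be positive; [fine] loses nothing, as the
    conjugate p/(p-1) is finite. *)
Lemma fine_hoelder_conjugate_gt0 (R : realType) (p : R) : 1 < p ->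
  0 < fine (hoelder_conjugate p%:E).
Proof.
move=> p1; have p0 : 0 < p by exact: lt_trans p1.
rewrite /hoelder_conjugate/= eqe gt_eqF// -EFinB inver gt_eqF ?subr_gt0//.
by rewrite -EFinM divr_gt0 ?subr_gt0.
Qed.

(** Being a weight does not depend on the exponents, and a bound with one [C] for all cubes passes
    to the supremum. *)
Lemma A_class_subset (R : realType) (d : nat) (p q : R) (r r' s s' : \bar R)
    (C : R) : 0 < C ->
  (forall (Q : set (euclid R d)) w,
    lorentz_norm_on q s' Q w *
      lorentz_norm_on (fine (hoelder_conjugate p%:E)) (hoelder_conjugate r') Q
        (fun x => (w x)^-1) <=
    C%:E * (lorentz_norm_on q s Q w *
      lorentz_norm_on (fine (hoelder_conjugate p%:E)) (hoelder_conjugate r) Q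
        (fun x => (w x)^-1)))%E ->
  A_class R d p r q s `<=` A_class R d p r' q s'.
Proof.
move=> C0 H w [ww wA]; split => //.
apply: (@le_lt_trans _ _ (C%:E * A_const p r q s w)%E); last first.
  by rewrite lte_mul_pinfty// lee_fin ltW.
apply: ge_ereal_sup => _ [Q cQ <-]; apply: (le_trans (H Q w)).
apply: lee_wpmul2l; first by rewrite lee_fin ltW.
by apply: ereal_sup_ubound; exists Q.
Qed.

Theorem proposition3p7 (R : realType) (d : nat) (p q : R) (r s : \bar R)
  (hp : 1 < p) (hpq : p <= q) (hr : (1 <= r)%E) (hs : (1 <= s)%E) :
  (forall s0 s1 : \bar R, (1 <= s0)%E -> (s0 <= s1)%E ->
     A_class R d p r q s0 `<=` A_class R d p r q s1) /\
  (forall r0 r1 : \bar R, (1 <= r0)%E -> (r0 <= r1)%E ->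
     A_class R d p r1 q s `<=` A_class R d p r0 q s).
Proof.
have q0 : 0 < q by rewrite (lt_le_trans _ hpq)// (lt_trans ltr01).
split=> [s0 s1 s01 les|r0 r1 r01 ler].
  have [C [C0 CP]] :=
    @lorentz_norm_on_embedding R d _ _ _ q0 (lt_le_trans lte01 s01) les.
  apply: (A_class_subset C0) => Q w; rewrite [leRHS]muleA.
  by apply: lee_wpmul2r; [exact: lorentz_norm_on_ge0|exact: CP].
(* Here the embedding acts on w^-1, from the second exponent r1' to the larger r0'; hence the
   inclusion goes from r1 to r0. *)
have r1' : (0 < hoelder_conjugate r1)%E.
  by rewrite (lt_le_trans lte01)// hoelder_conj_ge1// (le_trans r01).
have [C [C0 CP]] := @lorentz_norm_on_embedding R d _ _ _
  (fine_hoelder_conjugate_gt0 hp) r1' (le_hoelder_conjugate r01 ler).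
apply: (A_class_subset C0) => Q w; rewrite [leRHS]muleCA.
by apply: lee_wpmul2l; [exact: lorentz_norm_on_ge0|exact: CP].
Qed.
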